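(* Let $\mathcal{A}$ be a finite set of matrices in $SL(2,\mathbb{Z})$ with (strictly) positive coefficients. For every $D>0$ there exists $\Delta>0$ such that, for every $n\ge1$ and every choice of $A_1,\dots,A_n\in\mathcal{A}$, the property $\mathcal{S}(D,\Delta)$ is satisfied by $(A_1,\dots,A_n)$.
   Context: For $i\le j$ write $A_i^j=A_iA_{i+1}\cdots A_j$, and $\|x\|=\max_i|x_i|$. The property $\mathcal{S}(D,\Delta)$ is satisfied by $(A_1,\dots,A_n)$ (matrices in $SL(d,\mathbb{Z})$; here $d=2$) if the following holds: for every integer $s\ge1$, every increasing sequence of $2s$ integers $1\le\ell_1\le\ell_1'\le\ell_2\le\ell_2'\le\dots\le\ell_s\le\ell_s'\le n$ with $\ell_{j+1}\ge\ell_j'+\Delta$ for $j=1,\dots,s-1$, and all $p_1,\dots,p_s,p_1',\dots,p_s'\in\mathbb{Z}^d$ such that $A_1^{\ell_s'}p_s'+A_1^{\ell_s}p_s\ne0$ and $\|p_j\|,\|p_j'\|\le D$ for $j=1,\dots,s$, one has $$\sum_{j=1}^s\big[A_1^{\ell_j'}p_j'+A_1^{\ell_j}p_j\big]\ne0.$$ *)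

(* Defs.v *)
From mathcomp Require Import all_boot all_order all_algebra.
From mathcomp Require Import finmap.
From mathcomp Require Import reals matrix_normedtype.

Set Implicit Arguments.
Unset Strict Implicit.
Unset Printing Implicit Defensive.

Import Order.TTheory GRing.Theory Num.Theory.

Local Open Scope ring_scope.

(* A finite sequence indexed by 1, ..., n is represented by a function on nat
   whose values outside 1..n are never used. *)

(* A_i^j = A_i A_{i+1} ... A_j *)
Definition mxprod (d : nat) (A : nat -> 'M[int]_d) (i j : nat) : 'M[int]_d :=
  \prod_(i <= k < j.+1) A k.

Definition property_S (R : realType) (d : nat) (D Delta : R)
    (n : nat) (A : nat -> 'M[int]_d) : Prop :=
  forall (s : nat) (l l' : nat -> nat) (p p' : nat -> 'cV[int]_d),
    (1 <= s)%N ->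
    (1 <= l 1)%N ->
    (forall j, (1 <= j <= s)%N -> (l j <= l' j)%N) ->
    (forall j, (1 <= j < s)%N -> (l' j <= l j.+1)%N) ->
    (l' s <= n)%N ->
    (forall j, (1 <= j < s)%N -> (l' j)%:R + Delta <= (l j.+1)%:R) ->
    mxprod A 1 (l' s) *m p' s + mxprod A 1 (l s) *m p s <> 0 ->
    (forall j, (1 <= j <= s)%N ->
       (mx_norm (p j))%:~R <= D /\ (mx_norm (p' j))%:~R <= D) ->
    \sum_(1 <= j < s.+1)
       (mxprod A 1 (l' j) *m p' j + mxprod A 1 (l j) *m p j) <> 0.

(* Main.v *)
Require Import Defs.
From mathcomp Require Import all_boot all_order all_algebra.
From mathcomp Require Import finmap.
From mathcomp Require Import reals.
From mathcomp Require Import matrix_normedtype zify ring.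

(** The last pair of terms dominates the sum of all the earlier ones.

    Suppose that the sum vanishes, with [s >= 2] (for [s = 1] it is the
    vector assumed to be nonzero). Factoring [A_1^{l_s}] out of the last
    pair leaves [A_1^{l_s} v], where [v = A_{l_s+1}^{l'_s} p'_s + p_s] is a
    nonzero integer vector. Write [a_m] for the sum of the entries of
    [A_1^m].

    Upper bound ([norm1_partial_sum_le]). Multiplying by a positive integer
    2x2 matrix at least doubles the sum of the entries, so [a_m] grows
    geometrically, and the earlier terms sum to a vector of l1-norm at most
    [4 d a_{l'_{s-1}}], where [d] bounds the l1-norms of the [p_j], [p'_j].

    Lower bound. The vector [v] may be arbitrarily large and may have mixed
    signs, so that the first factors could contract it. However, there is a
    length [q], depending only on the set of matrices and on [d], such that
    the last [q] matrices of [A_1^{l_s}] send [v] to a vector whose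
    coordinates are all positive or all negative
    ([exists_one_signing_length]). The remaining [A_1^{l_s - q}] cannot
    contract such an integer vector: [|A_1^{l_s} v| >= a_{l_s - q}]. Since
    [a_{l_s - q} >= 2^{l_s - q - l'_{s-1}} a_{l'_{s-1}}], a gap
    [Delta > q + 4 d] contradicts the upper bound.

    The length [q] comes from arithmetic ([one_signed_of_det1]). If [M] has
    determinant 1 and entries at least [c], and [y = M x] does not lie in an
    open quadrant of constant sign, then [x = adj(M) y] adds up entries of
    [M] without cancellation, so an integer [x <> 0] has a coordinate of size
    at least [c]: long products give small nonzero integer vectors a constant
    sign. If [l'_s - l_s] is small, then [v] is bounded and this applies to
    [v]. If it is large and [p'_s <> 0], it applies to [p'_s]; the
    coordinates of [A_{l_s+1}^{l'_s} p'_s] are then large and of one sign,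
    and adding [p_s] does not change that sign. *)

Import Order.TTheory GRing.Theory Num.Theory.

Local Open Scope ring_scope.

Set Implicit Arguments.
Unset Strict Implicit.

(** * The entrywise l1-norm and lower bounds on entries *)

(** One norm serves matrices and column vectors: it is submultiplicative, and
    for nonnegative matrices it is additive, which turns growth of products
    into counting entries. *)
Definition norm1 m n (M : 'M[int]_(m, n)) : int :=
  \sum_i \sum_j `|M i j|.

Definition entries_ge m n (c : int) (M : 'M[int]_(m, n)) : Prop :=
  forall i j, c <= M i j.

Definition one_signed m n (M : 'M[int]_(m, n)) : Prop :=
  entries_ge 1 M \/ entries_ge 1 (- M).

Lemma norm1_ge0 m n (M : 'M[int]_(m, n)) : 0 <= norm1 M.
Proof. by do 2![apply: sumr_ge0 => ? _]. Qed.

Lemma norm1N m n (M : 'M[int]_(m, n)) : norm1 (- M) = norm1 M.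
Proof.
by apply: eq_bigr => i _; apply: eq_bigr => j _; rewrite mxE normrN.
Qed.

Lemma norm1D m n (M N : 'M[int]_(m, n)) : norm1 (M + N) <= norm1 M + norm1 N.
Proof.
rewrite /norm1 -big_split /=; apply: ler_sum => i _.
by rewrite -big_split /=; apply: ler_sum => j _; rewrite mxE ler_normD.
Qed.

Lemma norm1_entry m n (M : 'M[int]_(m, n)) i j : `|M i j| <= norm1 M.
Proof.
rewrite /norm1 (bigD1 i) //= (bigD1 j) //= -addrA lerDl addr_ge0 //.
  exact: sumr_ge0.
by do 2![apply: sumr_ge0 => ? _].
Qed.

Lemma norm1M m n p (A : 'M[int]_(m, n)) (B : 'M[int]_(n, p)) :
  norm1 (A *m B) <= norm1 A * norm1 B.
Proof.
rewrite {1 2}/norm1 mulr_suml; apply: ler_sum => i _.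
rewrite mulr_suml.
apply: (@le_trans _ _ (\sum_j \sum_k `|A i k| * `|B k j|)).
  apply: ler_sum => j _; rewrite mxE; apply: le_trans (ler_norm_sum _ _ _) _.
  by apply: ler_sum => k _; rewrite normrM.
rewrite exchange_big /=; apply: ler_sum => k _.
rewrite -mulr_sumr ler_wpM2l // /norm1 (bigD1 k) //= lerDl.
by do 2![apply: sumr_ge0 => ? _].
Qed.

(** There is no cancellation between nonnegative entries, and every entry of
    [A] is counted, with a weight at least 1, in each of the [p] columns. *)
Lemma norm1_mul_ge m n p (A : 'M[int]_(m, n)) (B : 'M[int]_(n, p)) :
  entries_ge 0 A -> entries_ge 1 B -> p%:R * norm1 A <= norm1 (A *m B).
Proof.
move=> A0 B1; rewrite /norm1 mulr_sumr; apply: ler_sum => i _.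
rewrite mulr_natl -[X in _ *+ X](card_ord p) -sumr_const.
apply: ler_sum => j _; rewrite mxE; apply: le_trans (ler_norm _).
apply: ler_sum => k _; rewrite ger0_norm //.
by rewrite ler_peMr.
Qed.

Lemma entries_geW m n (M : 'M[int]_(m, n)) a b :
  a <= b -> entries_ge b M -> entries_ge a M.
Proof. by move=> ab Mb i j; apply: le_trans (Mb i j). Qed.

Lemma entries_geM m n p a b (A : 'M[int]_(m, n)) (B : 'M[int]_(n, p)) :
  0 <= a -> 0 <= b -> entries_ge a A -> entries_ge b B ->
  entries_ge (n%:R * (a * b)) (A *m B).
Proof.
move=> a0 b0 Aa Bb i j; rewrite mxE mulr_natl -[X in _ *+ X](card_ord n).
by rewrite -sumr_const; apply: ler_sum => k _; apply: ler_pM.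
Qed.

Lemma entries_geD m n (c : int) (u p : 'M[int]_(m, n)) :
  entries_ge (c + 1) u -> norm1 p <= c -> entries_ge 1 (u + p).
Proof.
move=> uc pc i j; have -> : (u + p) i j = u i j + p i j by rewrite mxE.
have := uc i j; have := norm1_entry p i j; lia.
Qed.

Lemma one_signedM p (A : 'M[int]_2) (B : 'M[int]_(2, p)) :
  entries_ge 1 A -> one_signed B -> one_signed (A *m B).
Proof.
move=> A1 [B1|B1]; [left|right; rewrite -mulmxN];
  by apply: entries_geW (entries_geM _ _ A1 B1).
Qed.

(** This is why sign matters: a nonnegative matrix can contract an integer
    vector of mixed signs, but never one of constant sign. *)
Lemma norm1_mul_one_signed m n (A : 'M[int]_(m, n)) (u : 'cV[int]_n) :
  entries_ge 0 A -> one_signed u -> norm1 A <= norm1 (A *m u).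
Proof.
move=> A0 [u1|u1]; first by have := norm1_mul_ge A0 u1; rewrite mul1r.
by have := norm1_mul_ge A0 u1; rewrite mul1r mulmxN norm1N.
Qed.

(** * Matrices of determinant 1 give small integer vectors a constant sign *)

Lemma det_mx22 (R : comPzRingType) (M : 'M[R]_2) : \det M = M 0 0 * M 1 1 - M 0 1 * M 1 0.
Proof.
rewrite (expand_det_row _ 0) !big_ord_recl big_ord0 /cofactor !det_mx11 !mxE /= addr0.
rewrite !expr0 ?expr1 !mul1r mulN1r mulrN /=.
by do !f_equal; do ?[congr (M _ _)]; apply: val_inj.
Qed.

(** Solve [y = M x] for [x] with the adjugate. If [y] is outside both open
    quadrants of constant sign, then, up to replacing [y] by [- y], one
    coordinate is at least 1 and the other at most 0. One of the two formulas
    for the coordinates of [x] then adds two terms of the same sign, the first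
    of which has size at least [c], against [norm1 x < c]. *)
Lemma one_signed_of_det1 (c : int) (M : 'M[int]_2) (x : 'cV[int]_2) :
  \det M = 1 -> entries_ge c M -> x != 0 -> norm1 x < c -> one_signed (M *m x).
Proof.
rewrite det_mx22 => detM cM x_neq0 xc.
have c_gt0 : 0 < c by apply: le_lt_trans (norm1_ge0 x) xc.
have X i : `|x i 0| < c by apply: le_lt_trans (norm1_entry x i 0) xc.
set y := M *m x.
have yE i : y i 0 = M i 0 * x 0 0 + M i 1 * x 1 0.
  rewrite mxE !big_ord_recl big_ord0 addr0.
  by congr (M i _ * x _ _ + M i _ * x _ _); apply: val_inj.
have x0E : x 0 0 = M 1 1 * y 0 0 - M 0 1 * y 1 0.
  by rewrite -[LHS]mul1r -detM !yE; ring.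
have x1E : x 1 0 = M 0 0 * y 1 0 - M 1 0 * y 0 0.
  by rewrite -[LHS]mul1r -detM !yE; ring.
have x0NE : - x 0 0 = M 1 1 * - y 0 0 - M 0 1 * - y 1 0 by rewrite x0E; ring.
have x1NE : - x 1 0 = M 0 0 * - y 1 0 - M 1 0 * - y 0 0 by rewrite x1E; ring.
(* the sum without cancellation, shared by the four possible sign patterns *)
have big p q u v : c <= p -> c <= q -> 0 < u -> v <= 0 -> c <= p * u - q * v.
  move=> cp cq u0 v0; have cpu : c <= p * u.
    by apply: (le_trans cp); rewrite ler_peMr //; lia.
  have qv : q * v <= 0 by rewrite mulr_ge0_le0 //; lia.
  lia.
have ord2 (P : 'I_2 -> Prop) : P 0 -> P 1 -> forall i, P i.
  by move=> P0 P1 [[|[|k]] lt_k2] //; [move: P0 | move: P1];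
    congr P; apply: val_inj.
have y_neq0 : ~ (y 0 0 = 0 /\ y 1 0 = 0).
  case=> y0 y1; case/eqP: x_neq0; apply/matrixP => i j; rewrite ord1 mxE.
  by elim/ord2: i; rewrite ?x0E ?x1E y0 y1 !mulr0 subr0.
have b01 := big _ _ (y 0 0) (y 1 0) (cM 1 1) (cM 0 1).
have b10 := big _ _ (y 1 0) (y 0 0) (cM 0 0) (cM 1 0).
have n01 := big _ _ (- y 0 0) (- y 1 0) (cM 1 1) (cM 0 1).
have n10 := big _ _ (- y 1 0) (- y 0 0) (cM 0 0) (cM 1 0).
move: b01 b10 n01 n10 (X 0) (X 1); rewrite -x0E -x1E -x0NE -x1NE.
move=> b01 b10 n01 n10 X0 X1.
have : (1 <= y 0 0 /\ 1 <= y 1 0) \/ (1 <= - y 0 0 /\ 1 <= - y 1 0).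
  clear - y_neq0 b01 b10 n01 n10 X0 X1 c_gt0; lia.
by case=> -[h0 h1]; [left|right] => i j; rewrite ord1 ?[(- y) _ _]mxE;
  elim/ord2: i.
Qed.

(** * Products of positive matrices *)

Lemma mxprod_recr d (A : nat -> 'M[int]_d) i j : (i <= j.+1)%N ->
  mxprod A i j.+1 = mxprod A i j *m A j.+1.
Proof. by move=> ij; rewrite /mxprod big_nat_recr. Qed.

Lemma mxprod_cat d (A : nat -> 'M[int]_d) i j k : (i <= j.+1)%N -> (j <= k)%N ->
  mxprod A i k = mxprod A i j *m mxprod A j.+1 k.
Proof. by move=> ij jk; rewrite /mxprod (big_cat_nat ij). Qed.

Lemma det_mxprod d (A : nat -> 'M[int]_d) i j :
  (forall k, (i <= k <= j)%N -> \det (A k) = 1) -> \det (mxprod A i j) = 1.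
Proof.
move=> detA; rewrite /mxprod big_seq_cond; elim/big_ind: _.
- exact: det1.
- by move=> M N dM dN; rewrite [LHS]det_mulmx dM dN mulr1.
by move=> k /andP[]; rewrite mem_index_iota ltnS => /detA.
Qed.

Lemma entries_ge_mxprod (A : nat -> 'M[int]_2) i j : (i <= j)%N ->
  (forall k, (i <= k <= j)%N -> entries_ge 1 (A k)) ->
  entries_ge (2 ^+ (j - i)) (mxprod A i j).
Proof.
elim: j => [|j IH] ij A1.
  move: ij A1; rewrite leqn0 => /eqP-> A1.
  by rewrite /mxprod big_nat1 expr0; apply: A1.
move: ij A1; rewrite leq_eqVlt => /orP[/eqP-> | ij] A1.
  by rewrite /mxprod big_nat1 subnn expr0; apply: A1; rewrite leqnn.
rewrite mxprod_recr ?ltnS 1?ltnW // subSn // exprS -[X in _ * X]mulr1.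
apply: entries_geM => //; first exact: exprn_ge0.
  by apply: IH => // k /andP[ik kj]; apply: A1; rewrite ik leqW.
by apply: A1; rewrite leqnn andbT ltnW.
Qed.

(** The factor 2 is the norm of the identity matrix, which is the value of the
    empty product [j.+1 = i]. *)
Lemma norm1_mxprod_le (A : nat -> 'M[int]_2) (c : int) i j : (i <= j.+1)%N ->
  0 <= c -> (forall k, (i <= k <= j)%N -> norm1 (A k) <= c) ->
  norm1 (mxprod A i j) <= 2 * c ^+ (j.+1 - i).
Proof.
move=> ij c0; have norm1_1 : norm1 (1%:M : 'M[int]_2) = 2.
  by rewrite /norm1 !big_ord_recl !big_ord0 !mxE.
elim: j ij => [|j IH] ij Ac.
  case: i ij Ac => [|[|i]] // _ Ac.
    rewrite /mxprod big_nat1 expr1; apply: le_trans (Ac 0%N isT) _; lia.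
  by rewrite /mxprod big_geq // expr0 norm1_1.
move: ij; rewrite leq_eqVlt => /orP[/eqP-> | ij].
  by rewrite /mxprod big_geq // subnn expr0 norm1_1.
rewrite mxprod_recr // subSn // exprSr mulrA.
apply: le_trans (norm1M _ _) _; apply: ler_pM; rewrite ?norm1_ge0 //.
  by apply: IH => // k /andP[ik kj]; apply: Ac; rewrite ik leqW.
by apply: Ac; rewrite leqnn andbT.
Qed.

Lemma norm1_mxprod_growth (A : nat -> 'M[int]_2) i m k : (i <= m)%N -> (m <= k)%N ->
  (forall t, (i <= t <= k)%N -> entries_ge 1 (A t)) ->
  2 ^+ (k - m) * norm1 (mxprod A i m) <= norm1 (mxprod A i k).
Proof.
move=> im; elim: k => [|k IH] mk A1.
  by move: mk; rewrite leqn0 => /eqP->; rewrite mul1r.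
move: mk; rewrite leq_eqVlt => /orP[/eqP<- | mk].
  by rewrite subnn mul1r.
have A1' t : (i <= t <= k)%N -> entries_ge 1 (A t).
  by move=> /andP[it tk]; apply: A1; rewrite it leqW.
have ik : (i <= k)%N by lia.
rewrite subSn // exprS -mulrA mxprod_recr ?leqW //.
apply: le_trans (ler_wpM2l _ (IH mk A1')) _ => //.
apply: norm1_mul_ge; last by apply: A1; rewrite leqnn andbT leqW.
by apply: entries_geW (entries_ge_mxprod ik A1'); apply: exprn_ge0.
Qed.

Lemma ltr_expn2 (n : nat) : n%:Z < 2 ^+ n.
Proof. by rewrite -[n%:Z]natz -natrX ltr_nat ltn_expl. Qed.

(** What is used of the finite set of matrices: it is uniformly bounded and
    consists of positive matrices of determinant 1. *)
Definition letter (c : int) (M : 'M[int]_2) : Prop :=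
  [/\ \det M = 1, entries_ge 1 M & norm1 M <= c].

(** * The dominant vector acquires a constant sign *)

Lemma one_signed_mxprod (c : int) (d : nat) (A : nat -> 'M[int]_2) i j
    (x : 'cV[int]_2) :
  (forall k, (i <= k <= j)%N -> letter c (A k)) -> (i + d <= j)%N ->
  x != 0 -> norm1 x <= d%:Z -> one_signed (mxprod A i j *m x).
Proof.
move=> Ac ij x0 xd.
have A1 k : (i <= k <= j)%N -> entries_ge 1 (A k) by case/Ac.
apply: (@one_signed_of_det1 (2 ^+ (j - i))) => //.
- by apply: det_mxprod => k /Ac[].
- by apply: entries_ge_mxprod => //; lia.
apply: le_lt_trans xd _; apply: lt_le_trans (ltr_expn2 d) _.
by rewrite ler_eXn2l //; lia.
Qed.

(** The threshold [2 d + 1] leaves room, in a longer product, for two blocks of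
    length at least [d + 1]: the second one gives [p'] a constant sign, the
    first one then makes the coordinates exceed [d >= norm1 p], so that [p]
    cannot spoil the sign. A product up to the threshold has bounded entries,
    and if [p' = 0] the product is irrelevant. *)
Lemma one_signed_or_bounded (c : int) (d : nat) (A : nat -> 'M[int]_2) i j
    (p p' : 'cV[int]_2) :
  1 <= c -> (i <= j.+1)%N ->
  (forall k, (i <= k <= j)%N -> letter c (A k)) ->
  norm1 p <= d%:Z -> norm1 p' <= d%:Z ->
  one_signed (mxprod A i j *m p' + p)
  \/ norm1 (mxprod A i j *m p' + p) <= 2 * c ^+ (2 * d + 1) * d%:Z + d%:Z.
Proof.
move=> c1 ij Ac pd p'd.
have c0 : 0 <= c by apply: le_trans c1.
have bound0 : 0 <= 2 * c ^+ (2 * d + 1) * d%:Z.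
  by rewrite !mulr_ge0 // exprn_ge0.
have [p'0|p'_neq0] := eqVneq p' 0.
  by right; rewrite p'0 mulmx0 add0r; lia.
have [short|long] := leqP (j.+1 - i) (2 * d + 1).
  right; apply: le_trans (norm1D _ _) _; apply: lerD => //.
  apply: le_trans (norm1M _ _) _; apply: ler_pM => //; try exact: norm1_ge0.
  apply: le_trans (norm1_mxprod_le ij c0 _) _ => [k /Ac[]//|].
  by rewrite ler_wpM2l // ler_weXn2l.
left; set m := (j - d.+1)%N.
have im : (i + d <= m)%N by lia.
have mj : (m.+1 + d = j)%N by lia.
have M2 : one_signed (mxprod A m.+1 j *m p').
  apply: (@one_signed_mxprod c d) => //; last by rewrite mj.
  by move=> k /andP[mk kj]; apply: Ac; lia.
have M1 : entries_ge (2 ^+ (m - i)) (mxprod A i m).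
  apply: entries_ge_mxprod => [|k /andP[ik km]]; first by lia.
  by case: (Ac k) => //; lia.
have M1d : entries_ge (d%:Z + 1) (mxprod A i m).
  apply: entries_geW M1; apply: le_trans (_ : 2 ^+ d <= _).
    by have := ltr_expn2 d; lia.
  by rewrite ler_eXn2l //; lia.
have M1M u : entries_ge 1 u -> entries_ge (d%:Z + 1) (mxprod A i m *m u).
  move=> u1; apply: entries_geW (entries_geM _ _ M1d u1) => //.
  by rewrite mulr1; lia.
rewrite (@mxprod_cat 2 A i m j); [|lia..].
rewrite -mulmxA; case: M2 => M2.
  by left; exact: (entries_geD (M1M _ _ M2) pd).
right; rewrite opprD; apply: (entries_geD (c := d%:Z)); last by rewrite norm1N.
by rewrite -mulmxN; apply: M1M.
Qed.

(** The length works uniformly in [l' - l], however large the vector: a vector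
    beyond the bound of [one_signed_or_bounded] already has a constant sign,
    which positive matrices preserve. *)
Lemma exists_one_signing_length (c : int) (d : nat) : 1 <= c ->
  exists q : nat, forall (A : nat -> 'M[int]_2) l l' (p p' : 'cV[int]_2),
    (q <= l)%N -> (l <= l')%N ->
    (forall k, (l - q < k <= l')%N -> letter c (A k)) ->
    norm1 p <= d%:Z -> norm1 p' <= d%:Z ->
    mxprod A l.+1 l' *m p' + p != 0 ->
    one_signed (mxprod A (l - q).+1 l *m (mxprod A l.+1 l' *m p' + p)).
Proof.
move=> c1; pose E := `|(2 * c ^+ (2 * d + 1) * d%:Z + d%:Z)%R|%N.
exists E.+1 => A l l' p p' ql ll' Ac pd p'd v0.
have Ac1 k : ((l - E.+1).+1 <= k <= l)%N -> letter c (A k).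
  by move=> /andP[? ?]; apply: Ac; lia.
have Ac2 k : (l.+1 <= k <= l')%N -> letter c (A k).
  by move=> /andP[? ?]; apply: Ac; lia.
have ll1 : (l.+1 <= l'.+1)%N by [].
have [v1|vE] := one_signed_or_bounded c1 ll1 Ac2 pd p'd.
  apply: one_signedM => //.
  apply: entries_geW (entries_ge_mxprod _ _).
  - by rewrite exprn_ege1.
  - by lia.
  - by move=> k /Ac1[].
apply: (@one_signed_mxprod c E) => //; first by lia.
by apply: le_trans vE _; rewrite /E; lia.
Qed.

(** * The earlier terms are dominated *)

Lemma norm1_term_le (d : nat) (A : nat -> 'M[int]_2) l l' (p p' : 'cV[int]_2) :
  (1 <= l)%N -> (l <= l')%N ->
  (forall t, (1 <= t <= l')%N -> entries_ge 1 (A t)) ->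
  norm1 p <= d%:Z -> norm1 p' <= d%:Z ->
  norm1 (mxprod A 1 l' *m p' + mxprod A 1 l *m p)
    <= 2 * d%:Z * norm1 (mxprod A 1 l').
Proof.
move=> l1 ll' A1 pd p'd; apply: le_trans (norm1D _ _) _.
have -> : 2 * d%:Z * norm1 (mxprod A 1 l') =
  norm1 (mxprod A 1 l') * d%:Z + norm1 (mxprod A 1 l') * d%:Z by ring.
apply: lerD; apply: le_trans (norm1M _ _) _; apply: ler_pM;
  rewrite ?norm1_ge0 //.
apply: le_trans (norm1_mxprod_growth l1 ll' A1).
by rewrite ler_peMl ?norm1_ge0 // exprn_ege1.
Qed.

(** The constant 4 reproduces itself: since [l'_s < l'_{s+1}], the norm of the
    product doubles, so the bound [4 d a] for the first [s] pairs is at most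
    [2 d a'], and the new pair adds at most [2 d a']. The conclusion
    [1 <= l s.+1], which the induction needs in order to compare products with
    nonempty ones, is carried along. *)
Lemma norm1_partial_sum_le (d : nat) (A : nat -> 'M[int]_2) (s : nat)
    (l l' : nat -> nat) (p p' : nat -> 'cV[int]_2) :
  (1 <= l 1)%N ->
  (forall j, (1 <= j <= s.+1)%N -> (l j <= l' j)%N) ->
  (forall j, (1 <= j < s.+1)%N -> (l' j < l j.+1)%N) ->
  (forall t, (1 <= t <= l' s.+1)%N -> entries_ge 1 (A t)) ->
  (forall j, (1 <= j <= s.+1)%N -> norm1 (p j) <= d%:Z /\ norm1 (p' j) <= d%:Z) ->
  (1 <= l s.+1)%N /\
  norm1 (\sum_(1 <= j < s.+2)
       (mxprod A 1 (l' j) *m p' j + mxprod A 1 (l j) *m p j))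
    <= 4 * d%:Z * norm1 (mxprod A 1 (l' s.+1)).
Proof.
move=> l1; elim: s => [|s IH] ll' l'l A1 pd.
  split=> //; rewrite big_nat1; have [? ?] := pd 1%N isT.
  apply: le_trans (norm1_term_le (d := d) l1 (ll' 1%N isT) A1 _ _) _ => //.
  by rewrite ler_wpM2r ?norm1_ge0 //; lia.
have gap : (l' s.+1 < l s.+2)%N by apply: l'l; lia.
have lel : (l s.+2 <= l' s.+2)%N by apply: ll'; lia.
have [||||ls IHs] := IH.
- by move=> j ?; apply: ll'; lia.
- by move=> j ?; apply: l'l; lia.
- by move=> t ?; apply: A1; lia.
- by move=> j ?; apply: pd; lia.
have ls' : (l s.+1 <= l' s.+1)%N by apply: ll'; lia.
have l2 : (1 <= l s.+2)%N by lia.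
split=> //.
rewrite big_nat_recr //=; apply: le_trans (norm1D _ _) _.
have [|pd1 pd2] := pd s.+2; first by lia.
have := norm1_term_le l2 lel A1 pd1 pd2.
have l's1 : (1 <= l' s.+1)%N by lia.
have l's2 : (l' s.+1 <= l' s.+2)%N by lia.
have grow := norm1_mxprod_growth l's1 l's2 A1.
have double : 2 * norm1 (mxprod A 1 (l' s.+1)) <= norm1 (mxprod A 1 (l' s.+2)).
  apply: le_trans grow; apply: ler_wpM2r; first exact: norm1_ge0.
  have -> : (l' s.+2 - l' s.+1 = (l' s.+2 - l' s.+1).-1.+1)%N by lia.
  by rewrite exprS ler_peMr // exprn_ege1.
have : 2 * d%:Z * (2 * norm1 (mxprod A 1 (l' s.+1)))
   <= 2 * d%:Z * norm1 (mxprod A 1 (l' s.+2)) by rewrite ler_wpM2l // mulr_ge0.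
move: IHs; set S := norm1 _; set T := norm1 (_ + _).
move: (norm1 _) (norm1 _) => a b; lia.
Qed.

(** * Conclusion *)

Lemma norm1_le_mx_norm n (p : 'cV[int]_n) : norm1 p <= n%:R * mx_norm p.
Proof.
rewrite /norm1 mulr_natl -[X in _ *+ X](card_ord n) -sumr_const.
apply: ler_sum => i _; rewrite big_ord1 mx_normrE.
exact: (le_bigmax 0 (fun ij => `|p ij.1 ij.2|) (i, 0)).
Qed.

Lemma finite_letters (calA : {fset 'M[int]_2}) :
  (forall M : 'M[int]_2, M \in calA -> \det M = 1) ->
  (forall M : 'M[int]_2, M \in calA -> forall i j : 'I_2, 0 < M i j) ->
  exists2 c : int, 1 <= c & forall M, M \in calA -> letter c M.
Proof.
move=> hSL hpos; exists (1 + \sum_(M <- calA) norm1 M).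
  by rewrite lerDl sumr_ge0 // => M _; apply: norm1_ge0.
move=> M McalA; split; first exact: hSL.
  by move=> i j; have := hpos M McalA i j.
rewrite (big_rem M) //= addrCA lerDl addr_ge0 //.
by apply: sumr_ge0 => N _; apply: norm1_ge0.
Qed.

Unset Implicit Arguments.

Theorem corollary3p13 (R : realType) (calA : {fset 'M[int]_2})
    (hSL : forall M : 'M[int]_2, M \in calA -> \det M = 1)
    (hpos : forall M : 'M[int]_2, M \in calA -> forall i j : 'I_2, 0 < M i j)
    (D : R) (hD : 0 < D) :
  exists Delta : R, 0 < Delta /\
    forall (n : nat) (A : nat -> 'M[int]_2),
      (1 <= n)%N ->
      (forall k : nat, (1 <= k <= n)%N -> A k \in calA) ->
      property_S D Delta n A.
Proof.
have [c c1 calAc] := finite_letters hSL hpos.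
pose d := (2 * Num.bound D)%N.
have norm1_le (p : 'cV[int]_2) : (mx_norm p)%:~R <= D -> norm1 p <= d%:Z.
  move=> pD; apply: le_trans (norm1_le_mx_norm p) _.
  rewrite /d PoszM ler_wpM2l // -(ler_int R).
  by apply: le_trans pD _; apply/ltW/archi_boundP/ltW.
have [q one_signing] := exists_one_signing_length d c1.
exists (q + 4 * d + 1)%:R; split; first by rewrite ltr0n addn1.
move=> n A n1 AcalA s l l' p p' s1 l1 ll' _ l'n gap last_neq0 pD.
have {}gap j : (1 <= j < s)%N -> (l' j + (q + 4 * d + 1) <= l j.+1)%N.
  by move/gap; rewrite -natrD ler_nat.
have {}pD j : (1 <= j <= s)%N -> norm1 (p j) <= d%:Z /\ norm1 (p' j) <= d%:Z.
  by case/pD => /norm1_le ? /norm1_le.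
have Ac k : (1 <= k <= n)%N -> letter c (A k) by move=> /AcalA/calAc.
case: s s1 ll' gap last_neq0 pD l'n => // -[|s] _ ll' gap last_neq0 pD l'n.
  by rewrite big_nat1.
have gap_s : (l' s.+1 + (q + 4 * d + 1) <= l s.+2)%N by apply: gap; lia.
have lel : (l s.+2 <= l' s.+2)%N by apply: ll'; lia.
have [||||ls past_le] := @norm1_partial_sum_le d A s l l' p p' l1.
- by move=> j ?; apply: ll'; lia.
- by move=> j ?; have := gap j; lia.
- by move=> t ?; case: (Ac t) => //; lia.
- by move=> j ?; apply: pD; lia.
have ls' : (l s.+1 <= l' s.+1)%N by apply: ll'; lia.
rewrite big_nat_recr //=; move: past_le.
set past := \sum_(1 <= j < s.+2) _ => past_le sum0.
set L := l s.+2 in gap_s lel last_neq0 sum0 *.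
set v := mxprod A L.+1 (l' s.+2) *m p' s.+2 + p s.+2.
have lastE : mxprod A 1 (l' s.+2) *m p' s.+2 + mxprod A 1 L *m p s.+2
    = mxprod A 1 L *m v.
  by rewrite (@mxprod_cat 2 A 1 L) // mulmxDr mulmxA.
have v_neq0 : v != 0.
  by apply/eqP => v0; apply: last_neq0; rewrite lastE v0 mulmx0.
have [|pd p'd] := pD s.+2; first by lia.
(* only the last [q] of the matrices before position [L] are spent here *)
have w1 : one_signed (mxprod A (L - q).+1 L *m v).
  apply: one_signing => //; first by lia.
  by move=> k ?; apply: Ac; lia.
have A1 t : (1 <= t <= L - q)%N -> entries_ge 1 (A t).
  by move=> ?; case: (Ac t) => //; lia.
have last_ge : norm1 (mxprod A 1 (L - q)) <= norm1 past.
  have -> : past = - (mxprod A 1 L *m v) by apply/eqP; rewrite -addr_eq0 -lastE sum0.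
  rewrite norm1N (@mxprod_cat 2 A 1 (L - q) L); [|lia..].
  rewrite -mulmxA; apply: norm1_mul_one_signed w1.
  apply: entries_geW (entries_ge_mxprod _ A1); first exact: exprn_ge0.
  by lia.
have l'1 : (1 <= l' s.+1)%N by lia.
have l'L : (l' s.+1 <= L - q)%N by lia.
have grow := norm1_mxprod_growth l'1 l'L A1.
have a_gt0 : 0 < norm1 (mxprod A 1 (l' s.+1)).
  apply: lt_le_trans (norm1_entry _ 0 0); rewrite normr_gt0 gt_eqF //.
  have /entries_ge_mxprod/(_ 0 0) : forall k, (1 <= k <= l' s.+1)%N -> entries_ge 1 (A k).
    by move=> t ?; case: (Ac t) => //; lia.
  by move/(_ l'1); apply: lt_le_trans; apply: exprn_gt0.
(* the gap beyond [q] beats the constant of the upper bound: [2 ^ k > k] *)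
have : 4 * d%:Z < 2 ^+ (L - q - l' s.+1).
  apply: lt_le_trans (_ : 2 ^+ (4 * d) <= _).
    by have := ltr_expn2 (4 * d); rewrite PoszM.
  by rewrite ler_eXn2l //; lia.
rewrite -(ltr_pM2r a_gt0); lia.
Qed.
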